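(* Let $M,N\in\mathbb{N}$ be positive integers, let $\Psi\in\Gamma_0(\mathbb{R}^{MN})$, and let $\varphi:\mathbb{C}^{MN}\times\mathbb{R}^{MN}\to\mathbb{R}_+\cup\{\infty\}$ be the function defined in the context. For each $\boldsymbol{x}\in\mathbb{C}^{MN}$, let $\boldsymbol{\sigma}^\star_{\boldsymbol{x}}\in\mathbb{R}^{MN}$ be a minimizer of the function $\boldsymbol{\sigma}\mapsto\varphi(\boldsymbol{x},\boldsymbol{\sigma})+\Psi(\boldsymbol{\sigma})$ over $\mathbb{R}^{MN}$ (with $\boldsymbol{x}$ fixed). Then: (1) If $\Psi=0$ (identically zero), then $\boldsymbol{\sigma}^\star_{\boldsymbol{x}}=|\boldsymbol{x}|$. (2) If $\Psi\neq 0$ and $\boldsymbol{\sigma}^\star_{\boldsymbol{x}}=|\boldsymbol{x}|$, then $\boldsymbol{\sigma}^\star_{\boldsymbol{x}}$ minimizes $\Psi$ over $\mathbb{R}^{MN}$.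
   Context: $\Gamma_0(\mathbb{R}^{n})$ denotes the set of all proper lower semicontinuous convex functions from $\mathbb{R}^{n}$ to $\mathbb{R}\cup\{\infty\}$. $\mathbb{R}_+$ is the set of nonnegative real numbers. For $\boldsymbol{x}\in\mathbb{C}^{MN}$, $|\boldsymbol{x}|\in\mathbb{R}^{MN}$ denotes the entry-wise absolute value, i.e. $(|\boldsymbol{x}|)_k=|x_k|$. The function $\varphi$ is defined for $(\boldsymbol{x},\boldsymbol{\sigma})\in\mathbb{C}^{MN}\times\mathbb{R}^{MN}$ by $$\varphi(\boldsymbol{x},\boldsymbol{\sigma})=\sum_{k=1}^{MN}\phi(x_k,\sigma_k),$$ where $\phi:\mathbb{C}\times\mathbb{R}\to\mathbb{R}_+\cup\{\infty\}$ is given by $$\phi(x,\sigma)=\begin{cases}\dfrac{|x|^2}{2\sigma}+\dfrac{\sigma}{2} & \text{if }\sigma>0,\\[1ex] 0 & \text{if } x=0\text{ and }\sigma=0,\\ \infty & \text{otherwise.}\end{cases}$$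
   Formalization: Part (2) fails for x with a zero entry (MN=1, x=0, Ψ(σ)=-σ/4), so it is proved for each x with no zero entry, and for all x when σ*_x=|x| holds for every x; a minimizer must have a finite value, since (2) fails if φ(x,·)+Ψ≡∞. *)

(* Defs.v *)
From HB Require Import structures.
From mathcomp Require Import all_boot all_order all_algebra.
From mathcomp Require Import all_classical all_reals all_analysis.
From mathcomp Require Import complex.
Set Implicit Arguments.
Unset Strict Implicit.
Unset Printing Implicit Defensive.
Import Order.TTheory GRing.Theory Num.Theory.
Import numFieldNormedType.Exports.
Local Open Scope ring_scope.
Local Open Scope ereal_scope.

Section definitions.
Variable R : realType.

(* The modulus as a real number: the library's norm `|z| on R[i] is valued
   in R[i] itself. *)
Definition cabs (z : R[i]) : R := Normc.normc z.

Definition cabs_vec n (x : 'cV[R[i]]_n) : 'cV[R]_n := map_mx cabs x.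

Definition proper_fun (T : Type) (f : T -> \bar R) : Prop :=
  (forall s, -oo < f s) /\ (exists s, f s < +oo).

(* The library's convex_function is for real-valued functions only. When f
   never takes the value -oo, no sum below is of the form +oo - oo. *)
Definition convex_efun (E : lmodType R) (f : E -> \bar R) : Prop :=
  forall (s t : E) (a : R), (0 < a < 1)%R ->
    f (a *: s + (1 - a) *: t)%R <= a%:E * f s + (1 - a)%:E * f t.

Definition Gamma0 n (f : 'cV[R]_n -> \bar R) : Prop :=
  [/\ proper_fun f, lower_semicontinuous f & convex_efun f].

Definition phi (x : R[i]) (s : R) : \bar R :=
  if (0 < s)%R then (cabs x ^+ 2 / (2 * s) + s / 2)%R%:E
  else if (x == 0%R) && (s == 0%R) then 0 else +oo.

Definition varphi n (x : 'cV[R[i]]_n) (s : 'cV[R]_n) : \bar R :=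
  \sum_(k < n) phi (x k ord0) (s k ord0).

(* As usual in variational analysis, argmin f is empty when f is identically
   +oo: the minimal value has to be < +oo. *)
Definition minimizer (T : Type) (f : T -> \bar R) (s : T) : Prop :=
  f s < +oo /\ forall t, f s <= f t.

End definitions.

(* Main.v *)
Require Import Defs.
From HB Require Import structures.
From mathcomp Require Import all_boot all_order all_algebra.
From mathcomp Require Import all_classical all_reals all_analysis.
From mathcomp Require Import complex.
From mathcomp Require Import ring lra.
Import Order.TTheory GRing.Theory Num.Theory.
Import numFieldNormedType.Exports.
Local Open Scope ring_scope.

(** For s > 0, completing the square gives phi(x,s) = |x| + (s - |x|)^2 / (2s), so |x| is the unique
    minimizer of [phi x]; summing over the entries gives (1), see [varphi_min_eq]. If x has no zero
    entry, [varphi x] is differentiable at |x| with zero gradient. Near |x|, on the segment towards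
    any t, only Psi contributes at first order, and convexity turns this into Psi(|x|) <= Psi(t):
    this is [minimizer_cabs_nonzero]. At a zero entry phi(0,s) = s/2 for s >= 0, whose slope is 1/2,
    and that argument breaks down. Here the whole family of minimizers helps: |x| + e is |y| for
    some y without zero entry, hence minimizes Psi, and letting e tend to 0 gives
    [minimizer_cabs_all]. *)

Lemma le_add_small (R : realFieldType) (p q E A : R) : 0 <= E -> 0 < A ->
  (forall a, 0 < a <= A -> p <= q + a * E) -> p <= q.
Proof.
move=> E0 A0 H; apply/ler_addgt0Pr => e e0.
have E1 : 0 < E + 1 by rewrite ltr_wpDl.
(* The denominator [E + 1] instead of [E] covers the case [E = 0]. *)
have := H (Num.min A (e / (E + 1))).
rewrite lt_min A0 divr_gt0 // ge_min lexx => /(_ isT) /le_trans; apply.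
rewrite lerD2l; apply: (@le_trans _ _ (e / (E + 1) * E)).
  by rewrite ler_wpM2r // ge_min lexx orbT.
by rewrite mulrAC ler_pdivrMr // ler_wpM2l ?lerDl // ltW.
Qed.

Section Phi.
Variable R : realType.
Implicit Types (x : R[i]) (r s t a e : R).

Lemma cabs_ge0 x : 0 <= cabs x.
Proof. by case: x => u v; exact: sqrtr_ge0. Qed.

Lemma cabs_gt0 x : (0 < cabs x) = (x != 0).
Proof.
rewrite lt_neqAle cabs_ge0 andbT eq_sym; congr (~~ _).
by apply/eqP/eqP => [/Normc.eq0_normc //|->]; exact: Normc.normc0.
Qed.

Lemma cabs_real r : 0 <= r -> cabs (r%:C)%C = r.
Proof. by move=> r0; rewrite /cabs /= expr0n addr0 sqrtr_sqr ger0_norm. Qed.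

(** Completing the square isolates a nonnegative remainder that vanishes only at s = |x|; every
    estimate of [phi] at positive [s] below starts from this form. *)
Lemma phiE x s : 0 < s ->
  phi x s = (cabs x + (s - cabs x) ^+ 2 / (2 * s))%:E.
Proof. by move=> s0; rewrite /phi s0; congr _%:E; field; rewrite gt_eqF. Qed.

Lemma phi_ge x s : ((cabs x)%:E <= phi x s)%E.
Proof.
have [s0|s0] := ltP 0 s.
  by rewrite phiE // lee_fin lerDl divr_ge0 ?sqr_ge0 // mulr_ge0 // ltW.
rewrite /phi ltNge s0 /=; case: ifP => [/andP[/eqP-> _]|_]; last exact: leey.
by rewrite [cabs _]Normc.normc0.
Qed.

Lemma phi_cabs x : phi x (cabs x) = (cabs x)%:E.
Proof.
have [->|x0] := eqVneq x 0.
  by rewrite /phi [cabs _]Normc.normc0 ltxx !eqxx.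
by rewrite phiE ?cabs_gt0 // subrr expr0n mul0r addr0.
Qed.

Lemma phi_eq_cabs x s : phi x s = (cabs x)%:E -> s = cabs x.
Proof.
have [s0|s0] := ltP 0 s; last first.
  rewrite /phi ltNge s0 /=; case: ifP => [/andP[/eqP-> /eqP->] _|//].
  by rewrite [cabs _]Normc.normc0.
rewrite phiE // => -[/eqP]; rewrite -subr_eq0 addrAC subrr add0r.
rewrite mulf_eq0 invr_eq0 [2 * s == 0]gt_eqF ?mulr_gt0 // orbF.
by rewrite sqrf_eq0 subr_eq0 => /eqP.
Qed.

(** The remainder e^2 / (2(|x| + e)) is at most e/2. Unlike the quadratic bound of [phi_segment],
    this linear one also covers x = 0. *)
Lemma phi_shift x e : 0 < e -> (phi x (cabs x + e) <= (cabs x + e / 2)%:E)%E.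
Proof.
move=> e0; have x0 := cabs_ge0 x.
have xe0 : 0 < cabs x + e by rewrite ltr_wpDl.
rewrite phiE // lee_fin lerD2l addrAC subrr add0r.
rewrite ler_pdivrMr ?mulr_gt0 //; nra.
Qed.

(* phi x is differentiable at cabs x with derivative 0, whence the quadratic
   bound; the hypothesis on a keeps the segment point above cabs x / 2. *)
Lemma phi_segment x t a : x != 0 -> 0 < a ->
  2 * a * (`|t - cabs x| / cabs x) <= 1 ->
  (phi x (a * t + (1 - a) * cabs x)%R <=
   (cabs x + a ^+ 2 * ((t - cabs x) ^+ 2 / cabs x))%:E)%E.
Proof.
rewrite -cabs_gt0; set m := cabs x => m0 a0.
rewrite [2 * a * (_ / m)]mulrA ler_pdivrMr // mul1r => ad.
have := ler_norm (- (t - m)); rewrite normrN => dn.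
have -> : a * t + (1 - a) * m = m + a * (t - m) by ring.
have s0 : m <= 2 * (m + a * (t - m)) by nra.
have s1 : 0 < m + a * (t - m) by lra.
rewrite phiE // -/m lee_fin lerD2l addrAC subrr add0r exprMn -mulrA.
rewrite ler_wpM2l ?sqr_ge0 // ler_wpM2l ?sqr_ge0 //.
by rewrite lef_pV2 // posrE mulr_gt0.
Qed.

End Phi.

Section Varphi.
Variables (R : realType) (n : nat).
Implicit Types (x : 'cV[R[i]]_n) (s t : 'cV[R]_n) (Psi : 'cV[R]_n -> \bar R).

Lemma varphi_cabs x :
  varphi x (cabs_vec x) = (\sum_(k < n) cabs (x k ord0))%:E.
Proof.
by rewrite /varphi -sumEFin; apply: eq_bigr => k _; rewrite mxE phi_cabs.
Qed.

(** At |x| every term attains its lower bound [cabs (x k ord0)], so a strict excess in one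
    coordinate cannot be compensated by the others. *)
Lemma varphi_min_eq x s :
  (varphi x s <= varphi x (cabs_vec x))%E -> s = cabs_vec x.
Proof.
rewrite varphi_cabs -sumEFin /varphi => le.
apply/matrixP => k j; rewrite (ord1 j) mxE; apply: phi_eq_cabs; apply/eqP.
rewrite eq_le phi_ge andbT leNgt; apply/negP => lt.
move: le; rewrite leNgt => /negP; apply.
rewrite (bigD1 k) //= [ltRHS](bigD1 k) //=; apply: lte_leD => //.
  by rewrite sumEFin.
by apply: lee_sum => i _; exact: phi_ge.
Qed.

(** The minimal value is below +oo by definition of [minimizer], and properness excludes -oo. *)
Lemma minimizer_fin {Psi x} : proper_fun Psi ->
  minimizer (fun t => (varphi x t + Psi t)%E) (cabs_vec x) ->
  Psi (cabs_vec x) \is a fin_num.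
Proof.
move=> [Psi_gtNy _] [+ _]; rewrite varphi_cabs fin_numE gt_eqF //=.
by case: (Psi _).
Qed.

(* Moving from the minimizer towards t by a fraction a costs only O(a ^ 2) in
   varphi x, whereas by convexity Psi gains at least a (Psi(|x|) - Psi(t)). *)
Lemma minimizer_cabs_nonzero {Psi x} : proper_fun Psi -> convex_efun Psi ->
  (forall k, x k ord0 != 0) ->
  minimizer (fun t => (varphi x t + Psi t)%E) (cabs_vec x) ->
  minimizer Psi (cabs_vec x).
Proof.
move=> Psi_proper Psi_convex x0 min.
have Psi_fin := minimizer_fin Psi_proper min.
have [Psi_gtNy _] := Psi_proper; case: min => _ min.
split; first by rewrite ltey_eq Psi_fin.
move=> t; have [->|Psit_ltey] := eqVneq (Psi t) +oo%E; first exact: leey.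
have Psit_fin : Psi t \is a fin_num by rewrite fin_numE Psit_ltey gt_eqF.
pose m k := cabs (x k ord0).
have m0 k : 0 < m k by rewrite cabs_gt0.
pose r k := `|t k ord0 - m k| / m k.
have r0 k : 0 <= r k by rewrite divr_ge0 // ltW.
(* [D] bounds all the [r k] at once, so [a <= 1 / (2 D)] meets the hypothesis of [phi_segment] in
   every coordinate; the summand 1 makes [D] positive and forces [a < 1]. *)
pose D := 1 + \sum_k r k.
have D1 : 1 <= D by rewrite lerDl sumr_ge0.
have rD k : r k <= D.
  by rewrite /D (bigD1 k) //= addrCA lerDl addr_ge0 ?sumr_ge0.
pose E := \sum_k (t k ord0 - m k) ^+ 2 / m k.
have E0 : 0 <= E.
  by apply: sumr_ge0 => k _; rewrite divr_ge0 ?sqr_ge0 // ltW.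
rewrite -(fineK Psi_fin) -(fineK Psit_fin) lee_fin.
set p := fine _; set q := fine _.
apply: (@le_add_small _ _ _ E (2 * D)^-1) => // [|a /andP[a0 aD]].
  by rewrite invr_gt0; lra.
have {}aD : 2 * a * D <= 1.
  by move: aD; rewrite -ler_pdivlMr ?div1r; [|lra]; rewrite invfM; lra.
have a1 : a < 1 by nra.
have bound : (varphi x (a *: t + (1 - a) *: cabs_vec x) <=
              (\sum_k m k + a ^+ 2 * E)%:E)%E.
  rewrite /E mulr_sumr -big_split -sumEFin; apply: lee_sum => k _.
  rewrite !mxE; apply: phi_segment => //.
  by apply: le_trans aD; rewrite ler_wpM2l ?rD // mulr_ge0 // ltW.
have a01 : 0 < a < 1 by rewrite a0.
(* Once the common terms [\sum_k m k] and [(1 - a) * p] cancel, what is left is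
   [a * p <= a * q + a ^+ 2 * E], to be divided by [a]. *)
have := le_trans (min _) (leeD bound (Psi_convex t (cabs_vec x) a a01)).
rewrite varphi_cabs -(fineK Psi_fin) -(fineK Psit_fin) -/p -/q -/m.
rewrite -!EFinM -!EFinD lee_fin => {}bound.
have : a * p <= a * (q + a * E) by lra.
by rewrite ler_pM2l.
Qed.

(* The minimizer |x| is compared with |x| + e, which is again some |y|, with y
   free of zero entries and at a cost at most n e / 2 in varphi x. *)
Lemma minimizer_cabs_all {Psi} : proper_fun Psi -> convex_efun Psi ->
  (forall x, minimizer (fun t => (varphi x t + Psi t)%E) (cabs_vec x)) ->
  forall x, minimizer Psi (cabs_vec x).
Proof.
move=> Psi_proper Psi_convex min x.
have Psi_fin y := minimizer_fin Psi_proper (min y).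
split; first by rewrite ltey_eq Psi_fin.
move=> t; have [->|Psit_ltey] := eqVneq (Psi t) +oo%E; first exact: leey.
have Psit_fin : Psi t \is a fin_num.
  by rewrite fin_numE Psit_ltey gt_eqF //; case: Psi_proper.
rewrite -(fineK (Psi_fin x)) -(fineK Psit_fin) lee_fin.
apply: (@le_add_small _ _ _ (n%:R / 2) 1) => // e /andP[e0 _].
pose y : 'cV[R[i]]_n := \col_k (cabs (x k ord0) + e)%:C%C.
have cabs_y k : cabs (y k ord0) = cabs (x k ord0) + e.
  by rewrite mxE cabs_real // addr_ge0 ?cabs_ge0 // ltW.
have [|_ /(_ t) le_t] := minimizer_cabs_nonzero Psi_proper Psi_convex _ (min y).
  by move=> k; rewrite -cabs_gt0 cabs_y ltr_wpDl ?cabs_ge0.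
have bound : (varphi x (cabs_vec y) <=
              (\sum_k cabs (x k ord0) + e * (n%:R / 2))%:E)%E.
  have -> : e * (n%:R / 2) = \sum_(k < n) e / 2.
    by rewrite sumr_const card_ord -mulr_natr; ring.
  rewrite -big_split -sumEFin; apply: lee_sum => k _.
  by rewrite mxE cabs_y; exact: phi_shift.
(* Minimality at x is tested at |y| = |x| + e, where Psi(|y|) <= Psi(t) because |y| minimizes
   Psi. *)
have := le_trans ((min x).2 _) (leeD bound le_t).
rewrite varphi_cabs -(fineK (Psi_fin x)) -(fineK Psit_fin).
by rewrite -!EFinD lee_fin -addrA lerD2l addrC.
Qed.

End Varphi.

Theorem theorem1 (R : realType) (M N : nat) (hM : (0 < M)%N) (hN : (0 < N)%N)
    (Psi : 'cV[R]_(M * N) -> \bar R) (hPsi : Gamma0 Psi) :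
  (* (1) *)
  (Psi = (fun=> 0%E) ->
    forall (x : 'cV[R[i]]_(M * N)) (s : 'cV[R]_(M * N)),
      minimizer (fun t => (varphi x t + Psi t)%E) s -> s = cabs_vec x) /\
  (* (2), for one x without zero entry *)
  (Psi <> (fun=> 0%E) ->
    forall (x : 'cV[R[i]]_(M * N)) (s : 'cV[R]_(M * N)),
      (forall k, x k ord0 != 0) ->
      minimizer (fun t => (varphi x t + Psi t)%E) s ->
      s = cabs_vec x -> minimizer Psi s) /\
  (* (2), for the whole family of minimizers *)
  (Psi <> (fun=> 0%E) ->
    forall sstar : 'cV[R[i]]_(M * N) -> 'cV[R]_(M * N),
      (forall x, minimizer (fun t => (varphi x t + Psi t)%E) (sstar x)) ->
      (forall x, sstar x = cabs_vec x) ->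
      forall x, minimizer Psi (sstar x)).
Proof.
have [Psi_proper _ Psi_convex] := hPsi; split; [|split].
- move=> Psi0 x s [_ min]; apply: varphi_min_eq.
  by have := min (cabs_vec x); rewrite Psi0 !adde0.
- move=> _ x s x0 + es; rewrite {}es.
  exact: minimizer_cabs_nonzero.
- move=> _ sstar min es x; rewrite es.
  by apply: minimizer_cabs_all => // y; rewrite -es.
Qed.
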